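(* The finite abelian groups that occur as groups of units of integral domains of characteristic $0$ are exactly the cyclic groups of order $2$, $4$, or $6$. *)

(* Defs.v *)
From HB Require Import structures.
From mathcomp Require Import all_boot all_order all_algebra all_fingroup all_solvable.

Set Implicit Arguments.
Unset Strict Implicit.
Unset Printing Implicit Defensive.

Import GRing.Theory.
Local Open Scope ring_scope.

(* The library's {unit R} is only available when R is a finite ring; this is
   the same construction without the finiteness requirement. *)
Section UnitGroup.

Variable R : unitRingType.

Inductive unit_group : predArgType := UnitGroup (x : R) of x \is a GRing.unit.

Definition ugval (u : unit_group) : R := let: UnitGroup x _ := u in x.

HB.instance Definition _ := [isSub for ugval].
HB.instance Definition _ := [Choice of unit_group by <:].

Implicit Types u v w : unit_group.

Lemma ugvalP u : ugval u \is a GRing.unit.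
Proof. exact: (valP u). Qed.

Fact ug_mul_subproof u v : ugval u * ugval v \is a GRing.unit.
Proof. by rewrite unitrMr ugvalP. Qed.

Fact ug_inv_subproof u : (ugval u)^-1 \is a GRing.unit.
Proof. by rewrite unitrV ugvalP. Qed.

Definition ug_one : unit_group := UnitGroup (unitr1 R).
Definition ug_mul u v : unit_group := UnitGroup (ug_mul_subproof u v).
Definition ug_inv u : unit_group := UnitGroup (ug_inv_subproof u).

Fact ug_mulA : associative ug_mul.
Proof. by move=> u v w; apply: val_inj; rewrite /= mulrA. Qed.

Fact ug_mul1 : left_id ug_one ug_mul.
Proof. by move=> u; apply: val_inj; rewrite /= mul1r. Qed.

Fact ug_mulr1 : right_id ug_one ug_mul.
Proof. by move=> u; apply: val_inj; rewrite /= mulr1. Qed.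

Fact ug_mulV : left_inverse ug_one ug_inv ug_mul.
Proof. by move=> u; apply: val_inj; rewrite /= mulVr ?ugvalP. Qed.

Fact ug_mulrV : right_inverse ug_one ug_inv ug_mul.
Proof. by move=> u; apply: val_inj; rewrite /= divrr ?ugvalP. Qed.

HB.instance Definition _ :=
  isGroup.Build unit_group ug_mulA ug_mul1 ug_mulr1 ug_mulV ug_mulrV.

End UnitGroup.

(* Unlike \isog, this also applies when one of the groups is not a
   finGroupType. *)
Definition group_isomorphic (G H : groupType) : Prop :=
  exists f : {multiplicative G -> H}, bijective f.

Definition occurs_as_units_char0 (G : groupType) : Prop :=
  exists R : idomainType, has_pchar0 R /\ group_isomorphic G (unit_group R).

(* Main.v *)
From HB Require Import structures.
Require Import Defs.
From mathcomp Require Import all_boot all_order all_algebra all_fingroup all_solvable.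
From mathcomp Require Import all_field.
From mathcomp Require Import zify ring.

Import Order.TTheory GRing.Theory Num.Theory.

(** The orders 2, 4 and 6 are realised by [Z], the Gaussian integers and the
    Eisenstein integers.  Conversely, a finite unit group of an integral domain
    is cyclic, say generated by a primitive [n]-th root of unity [z], and [n] is
    even because [-1 <> 1].  If [n > 6] there is [k] prime to [n] with
    [1 < k < n - 1]; then [(z^k - 1) / (z - 1)] is a unit, hence equals some
    [z^j].  The integral relation [z^k + z^j = z^(j+1) + 1] can be transported
    to a primitive [n]-th root of unity in the algebraic complex numbers, where
    two pairs of numbers of modulus 1 with the same sum either coincide or have
    sum 0, and both alternatives are impossible. *)

(* [t] is the trace of the generator [g], which satisfies [g^2 = t g - 1]; the
   pair [(a, b)] stands for [a + b g].  Thus [quad false] is [Z[i]], and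
   [quad true] is [Z[g]] with [g] a primitive sixth root of unity. *)
Definition quad (t : bool) : Type := (int * int)%type.

HB.instance Definition _ t := GRing.Zmodule.copy (quad t) (int * int)%type.

(** * The rings of Gaussian and Eisenstein integers *)

Section QuadraticIntegers.

Local Open Scope ring_scope.

Variable t : bool.

Implicit Types x y z : quad t.

Let c : int := t%:R.

Definition quad_one : quad t := (1, 0).
Definition quad_mul x y : quad t :=
  (x.1 * y.1 - x.2 * y.2, x.1 * y.2 + x.2 * y.1 + c * (x.2 * y.2)).

Fact quad_mulA : associative quad_mul.
Proof. by move=> x y z; congr pair; rewrite /=; ring. Qed.
Fact quad_mulC : commutative quad_mul.
Proof. by move=> x y; congr pair; rewrite /=; ring. Qed.
Fact quad_mul1 : left_id quad_one quad_mul.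
Proof. by case=> a b; congr pair; rewrite /=; ring. Qed.
Fact quad_mulDl : left_distributive quad_mul +%R.
Proof. by move=> x y z; congr pair; rewrite /=; ring. Qed.
Fact quad_one_neq0 : quad_one != 0.
Proof. by []. Qed.

HB.instance Definition _ := GRing.Zmodule_isComNzRing.Build (quad t)
  quad_mulA quad_mulC quad_mul1 quad_mulDl quad_one_neq0.

Definition quad_norm x : int := x.1 ^+ 2 + c * (x.1 * x.2) + x.2 ^+ 2.
(** Conjugation sends the generator [g] to [t - g], the other root of [X^2 - t X + 1]. *)
Definition quad_conj x : quad t := (x.1 + c * x.2, - x.2).

Lemma quad_normM x y : quad_norm (x * y) = quad_norm x * quad_norm y.
Proof. by rewrite /quad_norm /=; ring. Qed.

Lemma quad_mul_conj x : quad_conj x * x = (quad_norm x, 0).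
Proof. by congr pair; rewrite /quad_norm /=; ring. Qed.

Lemma quad_norm_ge0 x : 0 <= quad_norm x.
Proof. by rewrite /quad_norm /c; case: x => a b /=; case: (t) => /=; nia. Qed.

Lemma quad_norm_eq0 x : quad_norm x = 0 -> x = 0.
Proof.
rewrite /quad_norm /c; case: x => a b /= N0.
have [-> ->] : a = 0 /\ b = 0 by move: N0; case: (t) => /= N0; nia.
by [].
Qed.

Definition quad_unit : {pred quad t} := fun x => quad_norm x == 1.
Definition quad_inv x : quad t := if x \in quad_unit then quad_conj x else x.

Fact quad_mulVr : {in quad_unit, left_inverse 1 quad_inv *%R}.
Proof. by move=> x ux; rewrite /quad_inv ux quad_mul_conj (eqP ux). Qed.

(** Norms are multiplicative and are nonnegative integers, so two norms with product 1 both equal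
    1. *)
Fact quad_unitP x y : y * x = 1 -> x \in quad_unit.
Proof.
move=> /(congr1 quad_norm); rewrite quad_normM.
have -> : quad_norm 1 = 1 by rewrite /quad_norm /=; ring.
have := quad_norm_ge0 x; have := quad_norm_ge0 y; rewrite unfold_in /quad_unit.
move: (quad_norm x) (quad_norm y) => m n n0 m0 nm1.
have n_gt0 : 0 < n by nia.
by apply/eqP; nia.
Qed.

Fact quad_invr_out : {in [predC quad_unit], quad_inv =1 id}.
Proof. by move=> x; rewrite inE /quad_inv => /negPf->. Qed.

HB.instance Definition _ :=
  GRing.ComNzRing_hasMulInverse.Build (quad t)
    quad_mulVr quad_unitP quad_invr_out.

Fact quad_mulf_eq0 x y : x * y = 0 -> (x == 0) || (y == 0).
Proof.
move=> /(congr1 quad_norm); rewrite quad_normM.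
have -> : quad_norm 0 = 0 by rewrite /quad_norm /=; ring.
by move/eqP; rewrite mulf_eq0 => /orP[]/eqP/quad_norm_eq0->; rewrite eqxx ?orbT.
Qed.

HB.instance Definition _ :=
  GRing.ComUnitRing_isIntegral.Build (quad t) quad_mulf_eq0.

Lemma quad_natr n : n%:R = (n%:R, 0) :> quad t.
Proof. by elim: n => // n IHn; rewrite !mulrS IHn. Qed.

Lemma quad_pchar0 : has_pchar0 (quad t).
Proof.
apply/pcharf0P => n; by rewrite quad_natr xpair_eqE eqxx andbT pnatr_eq0.
Qed.

Definition quad_gen : quad t := (0, 1).

End QuadraticIntegers.

Section CharacteristicZero.

Local Open Scope ring_scope.

(** * Units of the three rings, and the groups they realise *)

(** Four times the norm is [(2a + cb)^2 + (4 - c^2) b^2] with [c] equal to 0 or 1; this bounds [b],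
    and [a] by symmetry. *)
Lemma quad_unit_small t (x : quad t) : x \is a GRing.unit ->
  [/\ -1 <= x.1 <= 1, -1 <= x.2 <= 1 & quad_norm t x = 1].
Proof.
rewrite unfold_in /= /quad_unit => /eqP ux; split=> //; move: ux;
  by rewrite /quad_norm; case: x => a b /=; case: t => /=; nia.
Qed.
Lemma gaussian_unit (x : quad false) :
  x \is a GRing.unit -> exists j, x = quad_gen false ^+ j.
Proof.
case/quad_unit_small; case: x => a b /= ha hb.
have [->|[->|->]] : a = -1 \/ a = 0 \/ a = 1 by lia.
all: have [->|[->|->]] : b = -1 \/ b = 0 \/ b = 1 by lia.
all: rewrite /quad_norm //= => _.
- by exists 2%N.
- by exists 3%N.
- by exists 1%N.
- by exists 0%N.
Qed.

Lemma eisenstein_unit (x : quad true) :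
  x \is a GRing.unit -> exists j, x = quad_gen true ^+ j.
Proof.
case/quad_unit_small; case: x => a b /= ha hb.
have [->|[->|->]] : a = -1 \/ a = 0 \/ a = 1 by lia.
all: have [->|[->|->]] : b = -1 \/ b = 0 \/ b = 1 by lia.
all: rewrite /quad_norm //= => _.
(* The surviving pairs, in lexicographic order, are [-1], [g - 1], [-g], [g], [1 - g] and [1]. *)
- by exists 3%N.
- by exists 2%N.
- by exists 4%N.
- by exists 1%N.
- by exists 5%N.
- by exists 0%N.
Qed.

Lemma gaussian_prim : 4.-primitive_root (quad_gen false).
Proof.
apply/andP; split=> //; apply/forallP; case.
by do 4? [case; first by move=> ?; rewrite unity_rootE].
Qed.

Lemma eisenstein_prim : 6.-primitive_root (quad_gen true).
Proof.
apply/andP; split=> //; apply/forallP; case.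
by do 6? [case; first by move=> ?; rewrite unity_rootE].
Qed.

Lemma int_prim : 2.-primitive_root (-1 : int).
Proof.
apply/andP; split=> //; apply/forallP; case.
by do 2? [case; first by move=> ?; rewrite unity_rootE].
Qed.

Lemma int_unit (x : int) : x \is a GRing.unit -> exists j, x = (-1) ^+ j.
Proof. by case/orP=> /eqP->; [exists 0%N | exists 1%N]. Qed.

(** A generator of [G] is matched with [z]. Both have order [#|G|], so exponents agree modulo [#|G|]
    and any choice of logarithms gives the same map. *)
Lemma occurs_of_unit_generator (G : finGroupType) (R : idomainType) (z : R) :
    cyclic [set: G] -> has_pchar0 R -> #|G|.-primitive_root z ->
    (forall x : R, x \is a GRing.unit -> exists j, x = z ^+ j) ->
  occurs_as_units_char0 G.
Proof.
move=> /cyclicP[g genG] R0 zP zU; exists R; split=> //.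
have Uz : z \is a GRing.unit.
  by rewrite -(unitrX_pos _ (prim_order_gt0 zP)) (prim_expr_order zP) unitr1.
have og : #[g]%g = #|G| by rewrite /order -genG cardsT.
(* The boolean equality lets [xchoose] extract an exponent. *)
have lgP (x : G) : exists i, (x == g ^+ i)%g.
  have : x \in <[g]>%g by rewrite -genG inE.
  by case/cycleP=> i ->; exists i.
pose lg x := xchoose (lgP x).
have lgE x : (g ^+ lg x = x)%g by rewrite -(eqP (xchooseP (lgP x))).
have luP (u : unit_group R) : exists j, ugval u == z ^+ j.
  by case: (zU _ (ugvalP u)) => j ->; exists j.
pose lu u := xchoose (luP u).
have luE u : z ^+ lu u = ugval u by rewrite -(eqP (xchooseP (luP u))).
pose f x : unit_group R := UnitGroup (unitrX (lg x) Uz).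
have gz i j : (g ^+ i = g ^+ j)%g -> z ^+ i = z ^+ j.
  move/eqP; rewrite eq_expg_mod_order og => ij.
  by apply/eqP; rewrite (eq_prim_root_expr zP).
have zg i j : z ^+ i = z ^+ j -> (g ^+ i = g ^+ j)%g.
  move/eqP; rewrite (eq_prim_root_expr zP) => ij.
  by apply/eqP; rewrite eq_expg_mod_order og.
have fM : {morph f : x y / (x * y)%g}.
  by move=> x y; apply: val_inj => /=; rewrite -exprD; apply: gz; rewrite expgD !lgE.
pose fm := isMultiplicative.Build G (unit_group R) f fM.
pose F : {multiplicative G -> unit_group R} := HB.pack f fm.
exists F; exists (fun u => g ^+ lu u)%g => [x|u] /=.
  by rewrite -[RHS]lgE; apply: zg; rewrite luE.
by apply: val_inj; rewrite /= -luE; apply: gz; rewrite lgE.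
Qed.

(** * Transport of integral relations to algebraic numbers *)

Lemma intr_pchar0_eq0 (R : idomainType) (m : int) :
  has_pchar0 R -> (m%:~R == 0 :> R) = (m == 0).
Proof.
move/pcharf0P=> R0; case: m => m; first by rewrite -pmulrn R0.
by rewrite NegzE rmorphN /= oppr_eq0 -pmulrn R0.
Qed.

(** The resultant lies in the ideal of [p] and [q], so it vanishes at [x]; being an integer, it is 0
    by characteristic 0. Hence [p] and [q] have a nonconstant common divisor, which has a root in
    [algC]. Constant polynomials are treated apart. *)
Lemma algC_common_root (R : idomainType) (p q : {poly int}) (x : R) :
    has_pchar0 R -> root (map_poly intr p) x -> root (map_poly intr q) x ->
  exists z : algC, root (map_poly intr p) z /\ root (map_poly intr q) z.
Proof.
move=> R0.
have szC (r : {poly int}) : size (map_poly intr r : {poly algC}) = size r.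
  by apply: size_map_inj_poly => //; apply: intr_inj.
have const0 (r : {poly int}) : (size r <= 1)%N -> root (map_poly intr r) x -> r = 0.
  move/size1_polyC->; rewrite map_polyC rootC /= intr_pchar0_eq0 // => /eqP->.
  by rewrite polyC0.
have closed (r : {poly int}) : root (map_poly intr r) x ->
    exists z : algC, root (map_poly intr r) z.
  move=> rx; apply/closed_rootP; rewrite szC; apply/negP => /eqP sr1.
  by move: (const0 r); rewrite sr1 => /(_ isT rx) r0; rewrite r0 size_poly0 in sr1.
move=> px qx; have [/const0/(_ px)->|p_gt1] := leqP (size p) 1.
  by have [z qz] := closed q qx; exists z; rewrite rmorph0 root0.
have [/const0/(_ qx)->|q_gt1] := leqP (size q) 1.
  by have [z pz] := closed p px; exists z; rewrite rmorph0 root0.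
have res0 : resultant p q == 0.
  have [[u v] /= _] := resultant_in_ideal p_gt1 q_gt1.
  move=> /(congr1 (map_poly (intr : int -> R))).
  rewrite map_polyC rmorphD !rmorphM /= => /(congr1 (horner^~ x)).
  rewrite hornerC hornerD !hornerM (eqP px) (eqP qx) !mulr0 addr0 => /eqP.
  by rewrite intr_pchar0_eq0.
move: res0; rewrite resultant_eq0; set d := Pdiv.Idomain.gcdp p q => d_gt1.
have /closed_rootP[z dz] : size (map_poly intr d : {poly algC}) != 1%N.
  by rewrite szC neq_ltn d_gt1 orbT.
have dvd_root (r : {poly int}) :
    Pdiv.Idomain.dvdp d r -> root (map_poly (intr : int -> algC) r) z.
  (* Over [int], divisibility holds up to a nonzero scalar [c], which stays nonzero in [algC]. *)
  case/Pdiv.Idomain.dvdpP => [[c s]] /= c0.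
  move=> /(congr1 (map_poly (intr : int -> algC))).
  rewrite map_polyZ rmorphM /= => /(congr1 (horner^~ z)).
  rewrite hornerZ hornerM (eqP dz) mulr0 => /eqP.
  by rewrite mulf_eq0 intr_eq0 (negPf c0).
exists z; split; apply: dvd_root; first exact: Pdiv.Idomain.dvdp_gcdl.
exact: Pdiv.Idomain.dvdp_gcdr.
Qed.

(** Since [X^n - 1] is the product of the ['Phi_d] with [d] dividing [n], some ['Phi_d] kills [z];
    then [z^d = 1] forces [d = n]. *)
Lemma root_Cyclotomic_prim (R : idomainType) n (z : R) :
  n.-primitive_root z -> root (map_poly intr 'Phi_n) z.
Proof.
move=> zP; have n_gt0 := prim_order_gt0 zP.
have rootX m : root (map_poly intr ('X^m - 1 : {poly int})) z = (z ^+ m == 1).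
  by rewrite rmorphB rmorph1 /= map_polyXn /root !hornerE subr_eq0.
have : root (map_poly intr ('X^n - 1 : {poly int})) z.
  by rewrite rootX (prim_expr_order zP).
rewrite -prod_Cyclotomic // rmorph_prod /= /root horner_prod prodf_seq_eq0.
case/hasP=> d; rewrite -dvdn_divisors // => dn /= dz.
have d_gt0 := dvdn_gt0 n_gt0 dn.
have : root (map_poly intr ('X^d - 1 : {poly int})) z.
  rewrite -prod_Cyclotomic // rmorph_prod /= /root horner_prod prodf_seq_eq0.
  apply/hasP; exists d => //.
  by rewrite -dvdn_divisors.
rewrite rootX -(prim_order_dvd zP) => nd.
by have <- : d = n by apply/eqP; rewrite eqn_dvd dn.
Qed.

(** Adjoining ['Phi_n] to [p] keeps the order: its roots in [algC] are the primitive [n]-th roots of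
    unity. *)
Lemma algC_prim_common_root (R : idomainType) n (x : R) (p : {poly int}) :
    has_pchar0 R -> n.-primitive_root x -> root (map_poly intr p) x ->
  exists2 z : algC, n.-primitive_root z & root (map_poly intr p) z.
Proof.
move=> R0 xP px.
have phix := root_Cyclotomic_prim _ _ _ xP.
have [z [phiz pz]] := algC_common_root _ _ _ _ R0 phix px.
exists z => //.
have [w wP] := C_prim_root_exists (prim_order_gt0 xP).
by rewrite -(root_cyclotomic wP) -(Cintr_Cyclotomic wP).
Qed.

(* Conjugation turns [a + b = c + d] into [a^-1 + b^-1 = c^-1 + d^-1], hence
   [ab = cd] unless the common sum vanishes. *)
Lemma norm1_addr_eq (C : numClosedFieldType) (a b c d : C) :
    `|a| = 1 -> `|b| = 1 -> `|c| = 1 -> `|d| = 1 -> a + b = c + d ->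
  [\/ a + b = 0, a = c | a = d].
Proof.
move=> a1 b1 c1 d1 abcd.
have conjV (y : C) : `|y| = 1 -> y^* * y = 1.
  by move=> y1; rewrite mulrC -normCK y1 expr1n.
have := congr1 (fun y => y^* * (a * b * c * d)) abcd; rewrite !rmorphD /= => E.
have {E} : (a + b) * (c * d - a * b) = 0.
  rewrite mulrBr {2}abcd; apply/eqP; rewrite subr_eq0; apply/eqP.
  have -> : (a + b) * (c * d) = (a^* + b^* ) * (a * b * c * d).
    transitivity ((b^* * b) * a * (c * d) + (a^* * a) * b * (c * d)).
      by rewrite !conjV //; ring.
    by ring.
  rewrite E.
  transitivity ((c^* * c) * d * (a * b) + (d^* * d) * c * (a * b)); first by ring.
  by rewrite !conjV //; ring.
move/eqP; rewrite mulf_eq0 => /orP[/eqP->|/eqP e]; first by constructor.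
have : (a - c) * (a - d) = 0.
  have -> : (a - c) * (a - d) = a * a - a * (c + d) + c * d by ring.
  by rewrite -abcd; rewrite -(subrK (a * b) (c * d)) e; ring.
by move/eqP; rewrite mulf_eq0 !subr_eq0 => /orP[]/eqP; constructor.
Qed.

(** * Roots of unity and cyclotomic units *)

Lemma prim_root_norm (C : numClosedFieldType) n (z : C) :
  n.-primitive_root z -> `|z| = 1.
Proof.
move=> zP; apply/eqP; rewrite -(pexpr_eq1 (prim_order_gt0 zP)) ?normr_ge0 //.
by rewrite -normrX (prim_expr_order zP) normr1.
Qed.

Lemma cyclotomic_unit_not_prim_pow (R : idomainType) n (x : R) k j :
    has_pchar0 R -> n.-primitive_root x -> (1 < k < n.-1)%N ->
  x ^+ k - 1 != (x - 1) * x ^+ j.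
Proof.
move=> R0 xP /andP[k1 kn]; apply/negP => /eqP e.
pose p : {poly int} := 'X^k + 'X^j - ('X^(j.+1) + 1).
have hp (S : idomainType) (y : S) :
    root (map_poly intr p) y = (y ^+ k + y ^+ j == y ^+ j.+1 + 1).
  by rewrite /p !(rmorphB, rmorphD) rmorph1 /= !map_polyXn /root !hornerE subr_eq0.
have [|z zP] := algC_prim_common_root R n x p R0 xP.
  rewrite hp -subr_eq0; apply/eqP.
  have -> : x ^+ k + x ^+ j - (x ^+ j.+1 + 1) =
      (x ^+ k - 1) - (x - 1) * x ^+ j by rewrite exprS; ring.
  by rewrite e subrr.
rewrite hp => /eqP ez.
have n_gt0 := prim_order_gt0 zP.
have z1 i : `|z ^+ i| = 1 by rewrite normrX (prim_root_norm _ _ _ zP) expr1n.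
have [|||||s0|/eqP|/eqP] :=
  norm1_addr_eq algC (z ^+ k) (z ^+ j) (z ^+ j.+1) 1 => //.
- by rewrite normr1.
(* Here [z^k = - z^j] and [z^(j+1) = -1], so [z^(k+1) = 1] although [0 < k + 1 < n]. *)
- have zj0 : z ^+ j != 0 by rewrite -normr_eq0 z1 oner_eq0.
  have : z ^+ k.+1 == z ^+ 0.
    rewrite -(inj_eq (mulIf zj0)); apply/eqP.
    rewrite expr0 mul1r exprS.
    have := ez; rewrite s0 exprS => /eqP; rewrite eq_sym addr_eq0 => /eqP zz.
    have -> : z ^+ k = - z ^+ j by apply/eqP; rewrite -addr_eq0 s0.
    by rewrite mulrN mulNr zz mulN1r opprK.
  by rewrite (eq_prim_root_expr zP) mod0n modn_small //; lia.
(* Here [z^k = z^(j+1)] leaves [z^j = 1], so [z^k = z], against [1 < k < n]. *)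
- move=> kj; move: ez; rewrite (eqP kj) => /addrI/eqP zj.
  move: kj; rewrite exprS (eqP zj) mulr1 -[X in _ == X]expr1 (eq_prim_root_expr zP).
  by rewrite !modn_small; lia.
- by rewrite -[X in _ == X](expr0 z) (eq_prim_root_expr zP) mod0n modn_small; lia.
Qed.

(** If [l k = 1] modulo [n], then [x = (x^k)^l], so [x - 1] is also a multiple of [x^k - 1]; the two
    quotients, both geometric sums, are mutually inverse. *)
Lemma cyclotomic_unit (R : idomainType) n (x : R) k :
    n.-primitive_root x -> coprime k n -> (1 < n)%N ->
  exists2 u : R, u \is a GRing.unit & x ^+ k - 1 = (x - 1) * u.
Proof.
move=> xP kn n1; exists (\sum_(i < k) x ^+ i); last by rewrite subrX1.
have k_gt0 : (0 < k)%N.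
  by rewrite lt0n; apply: contraTneq kn => ->; rewrite /coprime gcd0n; lia.
have [l l' kl _] := egcdnP n k_gt0.
have kl1 : (l * k = 1 %[mod n])%N by rewrite kl (eqP kn) modnMDl.
have x1 : x - 1 != 0.
  by rewrite subr_eq0 -(prim_order_dvd xP 1) dvdn1 gtn_eqF.
apply/unitrPr; exists (\sum_(i < l) (x ^+ k) ^+ i).
apply: (mulfI x1); rewrite mulrA -subrX1 -subrX1 mulr1 -exprM mulnC.
congr (_ - _); apply/eqP.
by rewrite -[X in _ == X]expr1 (eq_prim_root_expr xP); apply/eqP.
Qed.

(* For [n = 2m] the witness is [m + 1] or [m + 2], whichever is odd. *)
Lemma exists_coprime_mid n :
  ~~ odd n -> (6 < n)%N -> exists2 k, coprime k n & (1 < k < n.-1)%N.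
Proof.
move=> en n6.
have [m nm] : exists m, n = m.*2 by exists n./2; rewrite even_halfK.
rewrite {}nm in en n6 *.
have [om|em] := boolP (odd m).
  (* As [n > 6] means [m > 3], indeed [m + 2 < 2m - 1]. *)
  exists m.+2; last by lia.
  rewrite -muln2 coprimeMr; apply/andP; split; last by rewrite coprimen2 /= om.
  by rewrite -[m.+2]addn2 coprime_sym /coprime gcdnDl -/(coprime _ _) coprimen2.
exists m.+1; last by lia.
by rewrite -muln2 coprimeMr coprimeSn coprimen2.
Qed.

(** * Finite unit groups in characteristic 0 *)

Lemma units_char0_cyclic (G : finGroupType) (R : idomainType)
    (f : {multiplicative G -> unit_group R}) :
    bijective f -> has_pchar0 R ->
  cyclic [set: G] /\ (#|G| = 2 \/ #|G| = 4 \/ #|G| = 6)%N.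
Proof.
move=> fB R0; have f_inj := bij_inj fB.
(* [{multiplicative _ -> _}] is a morphism of magmas: [f 1 = 1] is not part of it. *)
have f1 : f 1%g = 1%g by apply: (mulgI (f 1%g)); rewrite -gmulfM !mulg1.
have cycG : cyclic [set: G].
  (* The units are embedded in the fraction field, where finite multiplicative groups are cyclic. *)
  pose h x := tofrac (ugval (f x)).
  apply: (@field_mul_group_cyclic _ _ _ h) => [x y _ _|x _]; rewrite /h /=.
    by rewrite gmulfM /= rmorphM.
  split=> [/eqP|->]; last by rewrite f1 /= rmorph1.
  rewrite -(rmorph1 (tofrac (R := R))) tofrac_eq => /eqP fx1.
  by apply: f_inj; rewrite f1; apply: val_inj.
split=> //; have /cyclicP[g genG] := cycG.
have og : #[g]%g = #|G| by rewrite /order -genG cardsT.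
set n := #|G| in og *.
pose z := ugval (f g).
have fX i : ugval (f (g ^+ i)%g) = z ^+ i.
  elim: i => [|i IHi]; first by rewrite expg0 f1.
  by rewrite expgS gmulfM /= IHi exprS.
have zE i j : (z ^+ i == z ^+ j) = (i == j %[mod n]).
  by rewrite -!fX (inj_eq val_inj) (inj_eq f_inj) eq_expg_mod_order og.
have n_gt0 : (0 < n)%N by rewrite -og order_gt0.
have zP : n.-primitive_root z.
  have zn1 : z ^+ n = 1 by apply/eqP; rewrite -(expr0 z) zE modnn mod0n.
  have [m mP mn] := prim_order_exists n_gt0 zn1.
  have : (n %| m)%N by rewrite /dvdn -(mod0n n) -zE expr0 (prim_expr_order mP).
  by move=> nm; have <- : m = n by apply/eqP; rewrite eqn_dvd mn.
have zU (x : R) : x \is a GRing.unit -> exists j, x = z ^+ j.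
  move=> ux; have [h hK fK] := fB.
  have : h (UnitGroup ux) \in <[g]>%g by rewrite -genG inE.
  by case/cycleP=> j hj; exists j; rewrite -fX -hj fK.
have even_n : ~~ odd n.
  (* As [-1] is a power of [z], [(-1)^n = 1]; an odd [n] would give [2 = 0]. *)
  apply/negP => on; have [j j1] := zU (-1) (unitrN1 R).
  have : (-1) ^+ n = 1 :> R by rewrite j1 exprAC (prim_expr_order zP) expr1n.
  rewrite -signr_odd on expr1 => /eqP; rewrite eq_sym -subr_eq0 opprK.
  by move/pcharf0P: R0 => /(_ 2%N) ->.
have [n6|n6] := leqP n 6.
  by move: n_gt0 even_n n6; clear; move: n; do 7?[case=> //]; tauto.
have [k kn kmid] := exists_coprime_mid _ even_n n6.
have [|u uU e] := cyclotomic_unit R n z k zP kn; first by lia.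
have [j uj] := zU u uU.
by have := cyclotomic_unit_not_prim_pow R n z k j R0 zP kmid; rewrite e uj eqxx.
Qed.

End CharacteristicZero.

Theorem corollary3p2 (G : finGroupType) (abG : abelian [set: G]) :
  occurs_as_units_char0 G <->
  cyclic [set: G] /\ (#|G| = 2 \/ #|G| = 4 \/ #|G| = 6).
Proof.
split=> [[R [R0 [f fB]]]|[cycG oG]]; first exact: units_char0_cyclic fB R0.
have int0 : has_pchar0 int by apply/pcharf0P => n; rewrite pnatr_eq0.
case: oG => [|[]] oG.
- by apply: (occurs_of_unit_generator G _ _ cycG int0);
    rewrite ?oG; [apply: int_prim | apply: int_unit].
- by apply: (occurs_of_unit_generator G _ _ cycG (quad_pchar0 false));
    rewrite ?oG; [apply: gaussian_prim | apply: gaussian_unit].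
- by apply: (occurs_of_unit_generator G _ _ cycG (quad_pchar0 true));
    rewrite ?oG; [apply: eisenstein_prim | apply: eisenstein_unit].
Qed.
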